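(* Let $n\ge 1$, $1\le i\le n$ and $m\in\mathbb Z_{\ge 0}$. The set $B^{m,i}$ together with the maps $\operatorname{wt},\epsilon_l,\varphi_l,\tilde e_l,\tilde f_l$ ($l\in I=\{1,\dots,n\}$) is an abstract semiregular crystal of type $A_n$.
   Context: Notation for $\mathfrak{sl}_{n+1}$ (type $A_n$): $I=\{1,\dots,n\}$, simple roots $\alpha_l$, simple coroots $\alpha_l^\vee$, fundamental weights $\omega_l$, weight lattice $P=\bigoplus_{l\in I}\mathbb Z\omega_l$, positive roots $\alpha_{p,q}=\alpha_p+\alpha_{p+1}+\cdots+\alpha_q$ for $1\le p\le q\le n$. Abstract crystal: a set $B$ with maps $\operatorname{wt}:B\to P$, $\tilde e_l,\tilde f_l:B\to B\cup\{0\}$, $\epsilon_l,\varphi_l:B\to\mathbb Z\cup\{-\infty\}$ such that for all $l\in I$: (1) $\varphi_l(b)=\epsilon_l(b)+\langle\alpha_l^\vee,\operatorname{wt}(b)\rangle$; (2) $\operatorname{wt}(\tilde e_lb)=\operatorname{wt}(b)+\alpha_l$ if $\tilde e_lb\in B$; (3) $\operatorname{wt}(\tilde f_lb)=\operatorname{wt}(b)-\alpha_l$ if $\tilde f_lb\in B$; (4) $\epsilon_l(\tilde e_lb)=\epsilon_l(b)-1$, $\varphi_l(\tilde e_lb)=\varphi_l(b)+1$ if $\tilde e_lb\in B$; (5) $\epsilon_l(\tilde f_lb)=\epsilon_l(b)+1$, $\varphi_l(\tilde f_lb)=\varphi_l(b)-1$ if $\tilde f_lb\in B$; (6) $\tilde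 f_lb=b'$ iff $\tilde e_lb'=b$ for $b,b'\in B$; (7) if $\varphi_l(b)=-\infty$ then $\tilde f_lb=\tilde e_lb=0$. It is semiregular if $\epsilon_l(b)=\max\{k\ge0\mid\tilde e_l^kb\ne0\}$ and $\varphi_l(b)=\max\{k\ge0\mid\tilde f_l^kb\ne0\}$ for all $b\in B$, $l\in I$. The set $B^{m,i}$: all arrays $A=(a_{p,q})_{1\le p\le i,\ i\le q\le n}$ of non-negative integers ($p$ = column index, $q$ = row index) such that $\sum_{s=1}^k a_{\beta(s)}\le m$ for every sequence (Dyck path) $\beta(1),\dots,\beta(k)$, $k\ge1$, of index pairs with $\beta(1)=(1,i)$, $\beta(k)=(i,n)$, and such that $\beta(s)=(p,q)$ implies $\beta(s+1)\in\{(p,q+1),(p+1,q)\}$. Weight: $\operatorname{wt}(A)=m\omega_i-\sum_{1\le p\le i\le q\le n}a_{p,q}\alpha_{p,q}$. Auxiliary integers. For $l>i$ put $S_l(p)=\sum_{j=1}^{p}a_{j,l-1}+\sum_{j=p}^{i}a_{j,l}$ for $1\le p\le i$; let $p_+^l(A)$ (resp. $q_+^l(A)$) be the smallest (resp. largest) $p\in\{1,\dots,i\}$ at which $S_l$ is maximal. For $l<i$ put $T_l(p)=\sum_{j=i}^{p}a_{l,j}+\sum_{j=p}^{n}a_{l+1,j}$ for $i\le p\le n$; let $p_-^l(A)$ (resp. $q_-^l(A)$) be the largest (resp. smallest) $p\in\{i,\dots,n\}$ at which $T_l$ is maximal. Maps $\varphi_l,\epsilon_l$: $\varphi_i(A)=m-\sum_{j=1}^{i-1}a_{j,i}-\sum_{j=i}^{n}a_{i,j}$,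 $\epsilon_i(A)=a_{i,i}$; for $l>i$ with $p=p_+^l(A)$, $q=q_+^l(A)$: $\varphi_l(A)=\sum_{j=1}^{p}a_{j,l-1}-\sum_{j=1}^{p-1}a_{j,l}$, $\epsilon_l(A)=\sum_{j=q}^{i}a_{j,l}-\sum_{j=q+1}^{i}a_{j,l-1}$; for $l<i$ with $p=p_-^l(A)$, $q=q_-^l(A)$: $\varphi_l(A)=\sum_{j=p}^{n}a_{l+1,j}-\sum_{j=p+1}^{n}a_{l,j}$, $\epsilon_l(A)=\sum_{j=i}^{q}a_{l,j}-\sum_{j=i}^{q-1}a_{l+1,j}$. Kashiwara operators: $\tilde f_lA=0$ if $\varphi_l(A)=0$, $\tilde e_lA=0$ if $\epsilon_l(A)=0$. Otherwise: $\tilde f_i$ replaces $a_{i,i}$ by $a_{i,i}+1$; $\tilde e_i$ replaces $a_{i,i}$ by $a_{i,i}-1$; for $l>i$: $\tilde f_l$ decreases $a_{p,l-1}$ by 1 and increases $a_{p,l}$ by 1, where $p=p_+^l(A)$; $\tilde e_l$ increases $a_{q,l-1}$ by 1 and decreases $a_{q,l}$ by 1, where $q=q_+^l(A)$; for $l<i$: $\tilde f_l$ increases $a_{l,p}$ by 1 and decreases $a_{l+1,p}$ by 1, where $p=p_-^l(A)$; $\tilde e_l$ decreases $a_{l,q}$ by 1 and increases $a_{l+1,q}$ by 1, where $q=q_-^l(A)$. All other entries are unchanged. *)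

(* Defs.v *)
From mathcomp Require Import all_boot all_order all_algebra.
Set Implicit Arguments. Unset Strict Implicit. Unset Printing Implicit Defensive.
Import Order.TTheory GRing.Theory Num.Theory.
Local Open Scope ring_scope.

(* Elements of I = {1, .., n} are natural numbers l with 1 <= l <= n.  A weight
   is the row vector of its coordinates on omega_1, .., omega_n; the column of
   omega_l has (0-based) number l - 1. *)
Definition weight (n : nat) : Type := 'rV[int]_n.

Section RootDatum.
Variable n : nat.

Definition omega (l : nat) : 'rV[int]_n := \row_(k < n) (k.+1 == l)%:R.

(* The pairing of alpha_l^vee with a weight: coroots are dual to the omega_k. *)
Definition coroot (l : nat) (lam : 'rV[int]_n) : int :=
  \sum_(k < n | k.+1 == l) lam 0 k.

Definition cartan (k l : nat) : int :=
  if k == l then 2 else if (k == l.+1) || (l == k.+1) then -1 else 0.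

Definition simple_root (l : nat) : 'rV[int]_n :=
  \sum_(1 <= k < n.+1) cartan k l *: omega k.

Definition pos_root (p q : nat) : 'rV[int]_n :=
  \sum_(p <= l < q.+1) simple_root l.

End RootDatum.

(* Z u {-oo}, with None standing for -oo. *)
Definition intNinf : Type := option int.

Definition shift (x : intNinf) (c : int) : intNinf := omap (+%R^~ c) x.

(* In the type of e and f, None stands for the extra element 0. *)
Record crystal_data (n : nat) (T : Type) := CrystalData {
  wt : T -> weight n;
  eps : nat -> T -> intNinf;
  phi : nat -> T -> intNinf;
  cr_e : nat -> T -> option T;
  cr_f : nat -> T -> option T
}.

(* The underlying set is a subset B of an ambient type T; the first two
   conditions say that the operators restrict to maps B -> B u {0}. *)
Record abstract_crystal (n : nat) (T : Type) (B : T -> Prop)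
    (D : crystal_data n T) : Prop := AbstractCrystal {
  crystal_e_closed : forall l b b', (1 <= l <= n)%N -> B b ->
    cr_e D l b = Some b' -> B b';
  crystal_f_closed : forall l b b', (1 <= l <= n)%N -> B b ->
    cr_f D l b = Some b' -> B b';
  crystal_phi_eps : forall l b, (1 <= l <= n)%N -> B b ->
    phi D l b = shift (eps D l b) (coroot l (wt D b));
  crystal_wt_e : forall l b b', (1 <= l <= n)%N -> B b ->
    cr_e D l b = Some b' -> wt D b' = wt D b + simple_root n l;
  crystal_wt_f : forall l b b', (1 <= l <= n)%N -> B b ->
    cr_f D l b = Some b' -> wt D b' = wt D b - simple_root n l;
  crystal_eps_phi_e : forall l b b', (1 <= l <= n)%N -> B b ->
    cr_e D l b = Some b' ->
    eps D l b' = shift (eps D l b) (-1) /\ phi D l b' = shift (phi D l b) 1;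
  crystal_eps_phi_f : forall l b b', (1 <= l <= n)%N -> B b ->
    cr_f D l b = Some b' ->
    eps D l b' = shift (eps D l b) 1 /\ phi D l b' = shift (phi D l b) (-1);
  crystal_f_e : forall l b b', (1 <= l <= n)%N -> B b -> B b' ->
    cr_f D l b = Some b' <-> cr_e D l b' = Some b;
  crystal_Ninf : forall l b, (1 <= l <= n)%N -> B b ->
    phi D l b = None -> cr_f D l b = None /\ cr_e D l b = None
}.

Definition op_iter (T : Type) (g : T -> option T) (k : nat) (b : T) : option T :=
  iter k (obind g) (Some b).

(* x = max {k >= 0 | g^k b <> 0}, including the existence of the maximum *)
Definition is_max_iter (T : Type) (g : T -> option T) (b : T) (x : intNinf) : Prop :=
  exists k : nat, [/\ x = Some k%:Z, op_iter g k b <> None &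
    forall j : nat, op_iter g j b <> None -> (j <= k)%N].

Definition semiregular (n : nat) (T : Type) (B : T -> Prop)
    (D : crystal_data n T) : Prop :=
  forall l b, (1 <= l <= n)%N -> B b ->
    is_max_iter (cr_e D l) b (eps D l b) /\ is_max_iter (cr_f D l) b (phi D l b).

Definition argmaxs (F : nat -> int) (lo hi : nat) : seq nat :=
  [seq p <- index_iota lo hi.+1 | all (fun r => F r <= F p) (index_iota lo hi.+1)].
Definition first_argmax F lo hi : nat := head 0%N (argmaxs F lo hi).
Definition last_argmax F lo hi : nat := last 0%N (argmaxs F lo hi).

Section Arrays.
Variables n i : nat.

Definition cell : Type :=
  {c : 'I_n.+1 * 'I_n.+1 | (1 <= c.1 <= i)%N && (i <= c.2)%N}.

Definition pos (c : cell) : nat * nat :=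
  (nat_of_ord (val c).1, nat_of_ord (val c).2).

(* Arrays have arbitrary integer entries: that the operators keep entries
   non-negative is part of their preserving polytope m. *)
Definition array : Type := {ffun cell -> int}.

Definition ent (A : array) (p q : nat) : int :=
  if [pick c | pos c == (p, q)] is Some c then A c else 0.

Definition add_at (A : array) (p q : nat) (d : int) : array :=
  [ffun c => A c + (if pos c == (p, q) then d else 0)].

Definition dyck_step (c d : nat * nat) : bool :=
  (d == (c.1, c.2.+1)) || (d == (c.1.+1, c.2)).

(* The set B^{m,i}; the Dyck path is (1, i) :: s. *)
Definition polytope (m : nat) (A : array) : Prop :=
  (forall c, 0 <= A c) /\
  forall s : seq (nat * nat),
    path dyck_step (1%N, i) s -> last (1%N, i) s = (i, n) ->
    \sum_(c <- (1%N, i) :: s) ent A c.1 c.2 <= m%:Z.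

Definition array_wt (m : nat) (A : array) : 'rV[int]_n :=
  m%:Z *: omega n i -
  \sum_(1 <= p < i.+1) \sum_(i <= q < n.+1) ent A p q *: pos_root n p q.

Definition S_ (A : array) (l p : nat) : int :=
  \sum_(1 <= j < p.+1) ent A j l.-1 + \sum_(p <= j < i.+1) ent A j l.
Definition T_ (A : array) (l p : nat) : int :=
  \sum_(i <= j < p.+1) ent A l j + \sum_(p <= j < n.+1) ent A l.+1 j.

Definition p_plus A l := first_argmax (S_ A l) 1%N i.
Definition q_plus A l := last_argmax (S_ A l) 1%N i.
Definition p_minus A l := last_argmax (T_ A l) i n.
Definition q_minus A l := first_argmax (T_ A l) i n.

Definition array_phi (m l : nat) (A : array) : int :=
  if (l == i)%N then
    m%:Z - \sum_(1 <= j < i) ent A j i - \sum_(i <= j < n.+1) ent A i j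
  else if (i < l)%N then
    let p := p_plus A l in
    \sum_(1 <= j < p.+1) ent A j l.-1 - \sum_(1 <= j < p) ent A j l
  else
    let p := p_minus A l in
    \sum_(p <= j < n.+1) ent A l.+1 j - \sum_(p.+1 <= j < n.+1) ent A l j.

Definition array_eps (l : nat) (A : array) : int :=
  if (l == i)%N then ent A i i
  else if (i < l)%N then
    let q := q_plus A l in
    \sum_(q <= j < i.+1) ent A j l - \sum_(q.+1 <= j < i.+1) ent A j l.-1
  else
    let q := q_minus A l in
    \sum_(i <= j < q.+1) ent A l j - \sum_(i <= j < q) ent A l.+1 j.

Definition array_f (m l : nat) (A : array) : option array :=
  if array_phi m l A == 0 then None else Some (
    if (l == i)%N then add_at A i i 1
    else if (i < l)%N then
      let p := p_plus A l in add_at (add_at A p l.-1 (-1)) p l 1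
    else
      let p := p_minus A l in add_at (add_at A l p 1) l.+1 p (-1)).

Definition array_e (l : nat) (A : array) : option array :=
  if array_eps l A == 0 then None else Some (
    if (l == i)%N then add_at A i i (-1)
    else if (i < l)%N then
      let q := q_plus A l in add_at (add_at A q l.-1 1) q l (-1)
    else
      let q := q_minus A l in add_at (add_at A l q (-1)) l.+1 q 1).

Definition array_crystal (m : nat) : crystal_data n array :=
  CrystalData (array_wt m)
    (fun l A => Some (array_eps l A)) (fun l A => Some (array_phi m l A))
    array_e (array_f m).

End Arrays.

(* Main.v *)
Require Import Defs.
From mathcomp Require Import all_boot all_order all_algebra.
From mathcomp Require Import zify ring.

(** For l different from i, the operators e_l and f_l only see two adjacent
    lines of the array: the rows l - 1 and l if l > i, the columns l and l + 1
    if l < i.  Write x_lo, .., x_hi and y_lo, .., y_hi for the entries of the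
    earlier and of the later line.  Both S_l and T_l are the profile
      F(p) = x_lo + .. + x_p + y_p + .. + y_hi,
    the value of the path that crosses from the first line to the second at p.
    One of the two operators lowers: it moves a unit from x_p to y_p at the
    first maximum p of F; the other raises: it moves a unit from y_q to x_q at
    the last maximum q.  For l > i lowering is f_l, for l < i it is e_l, so
    both ranges of l are instances of one statement.

    Of the two numbers phi_l and eps_l, the one that goes with lowering is
    max F - (sum of the y), the other is max F - (sum of the x).  Lowering at p
    adds 1 to F before p, nothing at p and -1 after p; as p is the first
    maximum, max F is unchanged and p becomes the last maximum.  Hence the
    numbers change by one and raising undoes lowering, and conversely
    (lower_slide, raise_slide).

    The delicate point is that the polytope is preserved.  Lowering can only
    increase the sum along a path that visits the cell of y_p but not that of
    x_p.  Such a path crosses between the two lines at some r < p; rerouted so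
    as to cross at p, its sum over the old array grows by F(p) - F(r) >= 1, so
    its new sum is at most the old sum of the rerouted path, hence at most m
    (detour, reach_slide).  Raising is the same argument on reversed paths, in
    which the two lines and the order of the positions are exchanged.

    For l = i only the corner entry (i, i) changes.  A single path visits the
    corner, and phi_i is m minus its sum, so adding one to the corner stays in
    the polytope exactly as long as phi_i > 0 (reach_corner).

    Given this, semiregularity is automatic: each of the two numbers is a
    non-negative integer that its operator decreases by one, the operator being
    defined exactly where the number is nonzero (string_step_max). *)

Set Implicit Arguments. Unset Strict Implicit. Unset Printing Implicit Defensive.
Import Order.TTheory GRing.Theory Num.Theory.
Local Open Scope ring_scope.

(** * Strings of an operator *)

Section Strings.
Variables (T : Type) (B : T -> Prop).

(** All that the crystal axioms require of one operator on B, in a form that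
    can be iterated: applied both to (eps, phi, e, f) and to (phi, eps, f, e),
    it gives every axiom that does not mention the weight. *)
Definition string_step (d u : T -> int) (dn up : T -> option T) : Prop :=
  forall b, B b -> 0 <= d b /\
    if d b == 0 then dn b = None else exists b',
      [/\ dn b = Some b', B b', d b' = d b - 1, u b' = u b + 1 & up b' = Some b].

Lemma string_step_ext d d' u u' dn dn' up up' :
  d =1 d' -> u =1 u' -> dn =1 dn' -> up =1 up' ->
  string_step d' u' dn' up' -> string_step d u dn up.
Proof.
move=> Ed Eu Edn Eup H b Bb; rewrite Ed Edn; have [? Hb] := H b Bb.
split=> //; case: ifP Hb => // _ [b' [? ? ? ? ?]].
by exists b'; rewrite Ed !Eu Eup.
Qed.

Lemma string_stepP d u dn up b b' : string_step d u dn up -> B b ->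
  dn b = Some b' ->
  [/\ B b', d b' = d b - 1, u b' = u b + 1 & up b' = Some b].
Proof.
move=> H Bb; have [_] := H b Bb; case: ifP => _ => [->//|].
by case=> c [-> Bc Ed Eu Eup] [<-].
Qed.

Lemma string_step_max d u dn up b : string_step d u dn up -> B b ->
  is_max_iter dn b (Some (d b)).
Proof.
move=> H; have [k] : exists k : nat, (`|d b| <= k)%N by exists `|d b|%N.
have stuck c : d c = 0 -> dn c = None -> is_max_iter dn c (Some (d c)).
  move=> -> dnN; exists 0%N; split=> // -[//|j].
  rewrite /op_iter iterSr /= dnN.
  by have -> : iter j (obind dn) None = None by elim: j => //= j ->.
elim: k b => [|k IHk] b lek Bb; have [dge0] := H b Bb; case: eqP => [d0 dnN|dn0].
- exact: stuck.
- lia.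
- exact: stuck.
case=> b' [dnb Bb' db' _ _].
have [|j [[dj] itj maxj]] := IHk b' _ Bb'; first by lia.
have itS r : op_iter dn r.+1 b = op_iter dn r b' by rewrite /op_iter iterSr /= dnb.
exists j.+1; split=> [||[|r]] //; first by congr Some; lia.
- by rewrite itS.
by rewrite itS => /maxj.
Qed.

End Strings.

(** * First and last maxima *)

Section Argmax.
Variables (F : nat -> int) (lo hi : nat).
Hypothesis lohi : (lo <= hi)%N.

Definition is_argmax p :=
  (lo <= p <= hi)%N /\ forall r, (lo <= r <= hi)%N -> F r <= F p.

Lemma argmaxsP p : reflect (is_argmax p) (p \in argmaxs F lo hi).
Proof.
rewrite mem_filter mem_index_iota ltnS andbC.
apply: (iffP andP) => [[rp /allP maxp]|[rp maxp]]; split=> //.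
  by move=> r rr; apply: maxp; rewrite mem_index_iota ltnS.
by apply/allP => r; rewrite mem_index_iota ltnS => /maxp.
Qed.

Lemma argmaxs_neq0 : argmaxs F lo hi <> [::].
Proof.
have [p maxp] : exists p, is_argmax p.
  have: (size (index_iota lo hi.+1) > 0)%N by rewrite size_iota; lia.
  case: (Order.TotalTheory.arg_maxP (i0 := ord0 : 'I_(hi - lo).+1) 
     (P := predT) (fun r : 'I_(hi - lo).+1 => F (lo + r)) isT) => p _ maxp _.
  exists (lo + p)%N; split; first by have := ltn_ord p; lia.
  move=> r rr; have rlt : (r - lo < (hi - lo).+1)%N by lia.
  by have := maxp (Ordinal rlt) isT; rewrite /= subnKC //; lia.
by move=> E; move/argmaxsP: maxp; rewrite E.
Qed.

Lemma argmaxs_sorted : sorted ltn (argmaxs F lo hi).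
Proof. by apply: (sorted_filter ltn_trans); apply: iota_ltn_sorted. Qed.

Lemma first_argmaxP : is_argmax (first_argmax F lo hi) /\
  forall r, (lo <= r < first_argmax F lo hi)%N -> F r < F (first_argmax F lo hi).
Proof.
rewrite /first_argmax; have := argmaxs_sorted; have := argmaxsP.
case: (argmaxs F lo hi) argmaxs_neq0 => [//|p s] _ inP; rewrite /= => srt.
have [rp maxp] : is_argmax p by apply/inP; rewrite mem_head.
split=> // r rr; rewrite lt_neqAle maxp ?andbT; last by lia.
apply/eqP => Frp; suff /inP : is_argmax r.
  rewrite inE => /orP[/eqP|/(allP (order_path_min ltn_trans srt))] /=; lia.
by split; [lia | rewrite Frp].
Qed.

Lemma last_argmaxP : is_argmax (last_argmax F lo hi) /\
  forall r, (last_argmax F lo hi < r <= hi)%N -> F r < F (last_argmax F lo hi).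
Proof.
rewrite /last_argmax; have := argmaxs_sorted; have := argmaxsP.
case/lastP: (argmaxs F lo hi) argmaxs_neq0 => [//|s p] _ inP; rewrite last_rcons.
move=> srt; have [rp maxp] : is_argmax p by apply/inP; rewrite mem_rcons mem_head.
split=> // r rr; rewrite lt_neqAle maxp ?andbT; last by lia.
apply/eqP => Frp; suff /inP : is_argmax r.
  move: srt; rewrite -(rev_sorted) rev_rcons /= => srt.
  rewrite mem_rcons inE -mem_rev => /orP[/eqP|]; first by lia.
  have gt_trans : transitive (fun u v => ltn v u) by move=> a b c /=; lia.
  by move/(allP (order_path_min gt_trans srt)) => /=; lia.
by split; [lia | rewrite Frp].
Qed.

Lemma first_argmax_eq p : is_argmax p ->
  (forall r, (lo <= r < p)%N -> F r < F p) -> first_argmax F lo hi = p.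
Proof.
move=> [rp maxp] ltp; have [[rq maxq] ltq] := first_argmaxP.
case: (ltngtP (first_argmax F lo hi) p) => // h.
- by have := ltp (first_argmax F lo hi); have := maxq p; lia.
- by have := ltq p; have := maxp (first_argmax F lo hi); lia.
Qed.

Lemma last_argmax_eq p : is_argmax p ->
  (forall r, (p < r <= hi)%N -> F r < F p) -> last_argmax F lo hi = p.
Proof.
move=> [rp maxp] ltp; have [[rq maxq] ltq] := last_argmaxP.
case: (ltngtP (last_argmax F lo hi) p) => // h.
- by have := ltq p; have := maxp (last_argmax F lo hi); lia.
- by have := ltp (last_argmax F lo hi); have := maxq p; lia.
Qed.

End Argmax.

Lemma sum_bump (x : nat -> int) k d a b :
  \sum_(a <= j < b) (x j + (if j == k then d else 0)) =
  \sum_(a <= j < b) x j + (if (a <= k < b)%N then d else 0).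
Proof. by rewrite big_split /= -big_mkcond /= big_nat1_eq. Qed.

(** * The profile of two lines *)

Section Profile.
Variables (lo hi : nat).
Hypothesis lohi : (lo <= hi)%N.

Definition profile (x y : nat -> int) (p : nat) : int :=
  \sum_(lo <= j < p.+1) x j + \sum_(p <= j < hi.+1) y j.

Definition first_peak x y := first_argmax (profile x y) lo hi.
Definition last_peak x y := last_argmax (profile x y) lo hi.

Definition lower_num (x y : nat -> int) : int :=
  let p := first_peak x y in
  \sum_(lo <= j < p.+1) x j - \sum_(lo <= j < p) y j.
Definition raise_num (x y : nat -> int) : int :=
  let q := last_peak x y in
  \sum_(q <= j < hi.+1) y j - \sum_(q.+1 <= j < hi.+1) x j.

Lemma profileS x y p : (lo <= p < hi)%N ->
  profile x y p.+1 - profile x y p = x p.+1 - y p.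
Proof.
move=> rp; rewrite /profile (big_nat_recr p.+1) /=; last by lia.
rewrite (big_ltn (m := p)); last by lia.
by set s := (\sum_(_ <= _ < p.+1) _); ring.
Qed.

Lemma lower_numE x y : lower_num x y =
  profile x y (first_peak x y) - \sum_(lo <= j < hi.+1) y j.
Proof.
rewrite /lower_num /profile; have [[rp _] _] := first_argmaxP (profile x y) lohi.
rewrite -/(first_peak x y) in rp *.
rewrite (@big_cat_nat _ _ _ (first_peak x y) lo hi.+1) /=; [|lia|lia].
ring.
Qed.

Lemma raise_numE x y : raise_num x y =
  profile x y (last_peak x y) - \sum_(lo <= j < hi.+1) x j.
Proof.
rewrite /raise_num /profile; have [[rp _] _] := last_argmaxP (profile x y) lohi.
rewrite -/(last_peak x y) in rp *.
rewrite (@big_cat_nat _ _ _ (last_peak x y).+1 lo hi.+1) /=; [|lia|lia].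
ring.
Qed.

(** The maximum of the profile cancels; the difference is what the weight
    pairs to with the coroot. *)
Lemma raise_sub_lower x y : raise_num x y - lower_num x y =
  \sum_(lo <= j < hi.+1) y j - \sum_(lo <= j < hi.+1) x j.
Proof.
suff E : profile x y (first_peak x y) = profile x y (last_peak x y).
  by rewrite raise_numE lower_numE E; ring.
have [[rf mf] _] := first_argmaxP (profile x y) lohi.
have [[rl ml] _] := last_argmaxP (profile x y) lohi.
by apply/eqP; rewrite eq_le mf ?ml.
Qed.

Lemma profile_lo x y : profile x y lo = x lo + \sum_(lo <= j < hi.+1) y j.
Proof. by rewrite /profile big_nat1. Qed.

Lemma profile_hi x y : profile x y hi = \sum_(lo <= j < hi.+1) x j + y hi.
Proof. by rewrite /profile big_nat1. Qed.

Lemma lower_num_ge0 x y : (forall j, 0 <= x j) -> 0 <= lower_num x y.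
Proof.
move=> x0; rewrite lower_numE; have [[_ mx] _] := first_argmaxP (profile x y) lohi.
have := mx lo; rewrite -/(first_peak x y) profile_lo; have := x0 lo; lia.
Qed.

Lemma raise_num_ge0 x y : (forall j, 0 <= y j) -> 0 <= raise_num x y.
Proof.
move=> y0; rewrite raise_numE; have [[_ mx] _] := last_argmaxP (profile x y) lohi.
have := mx hi; rewrite -/(last_peak x y) profile_hi; have := y0 hi; lia.
Qed.

(** The unit that lowering removes is available: either the first maximum is
    at lo and the number is x_lo itself, or the profile rises strictly into it,
    by x_p - y_(p-1). *)
Lemma lower_num_pos x y : (forall j, 0 <= y j) -> 0 < lower_num x y ->
  0 < x (first_peak x y).
Proof.
move=> y0; rewrite lower_numE; have [[rp _]] := first_argmaxP (profile x y) lohi.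
rewrite -/(first_peak x y) in rp *; case: (posnP (first_peak x y - lo)) => h lt.
  have -> : first_peak x y = lo by lia.
  by rewrite profile_lo; lia.
have := lt (first_peak x y).-1; have := @profileS x y (first_peak x y).-1.
have := y0 (first_peak x y).-1; rewrite prednK; lia.
Qed.

Lemma raise_num_pos x y : (forall j, 0 <= x j) -> 0 < raise_num x y ->
  0 < y (last_peak x y).
Proof.
move=> x0; rewrite raise_numE; have [[rp _]] := last_argmaxP (profile x y) lohi.
rewrite -/(last_peak x y) in rp *; case: (posnP (hi - last_peak x y)) => h lt.
  have -> : last_peak x y = hi by lia.
  by rewrite profile_hi; lia.
have := lt (last_peak x y).+1; have := @profileS x y (last_peak x y).
have := x0 (last_peak x y).+1; lia.
Qed.

Section Slide.
Variables (x y x' y' : nat -> int) (k : nat) (d : int).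
Hypothesis rk : (lo <= k <= hi)%N.
Hypothesis x'E : forall j, x' j = x j + (if j == k then d else 0).
Hypothesis y'E : forall j, y' j = y j - (if j == k then d else 0).

Lemma sum_slide_x a b : \sum_(a <= j < b) x' j =
  \sum_(a <= j < b) x j + (if (a <= k < b)%N then d else 0).
Proof. by rewrite -sum_bump; apply: eq_bigr. Qed.

Lemma sum_slide_y a b : \sum_(a <= j < b) y' j =
  \sum_(a <= j < b) y j - (if (a <= k < b)%N then d else 0).
Proof.
transitivity (\sum_(a <= j < b) y j + (if (a <= k < b)%N then - d else 0)).
  by rewrite -sum_bump; apply: eq_bigr => j _; rewrite y'E; case: eqP; lia.
by case: ifP; lia.
Qed.

Lemma profile_slide r : (lo <= r <= hi)%N -> profile x' y' r =
  profile x y r + (if (k < r)%N then d else if (r < k)%N then - d else 0).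
Proof.
move=> rr; rewrite /profile sum_slide_x sum_slide_y.
have -> : (lo <= k < r.+1)%N = (k <= r)%N by lia.
have -> : (r <= k < hi.+1)%N = (r <= k)%N by lia.
by case: (ltngtP k r) => _; ring.
Qed.

End Slide.

(** The profile rises by one before k and falls by one after it.  Values
    before the first maximum k were smaller than F(k) and become at most F(k),
    those after k become smaller: k turns into the last maximum, with the same
    value. *)
Lemma lower_slide (x y x' y' : nat -> int) (k := first_peak x y) :
  (forall j, x' j = x j + (if j == k then -1 else 0)) ->
  (forall j, y' j = y j - (if j == k then -1 else 0)) ->
  [/\ last_peak x' y' = k, lower_num x' y' = lower_num x y - 1
    & raise_num x' y' = raise_num x y + 1].
Proof.
move=> x'E y'E; have [[rk maxk] ltk] := first_argmaxP (profile x y) lohi.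
rewrite -/(first_peak x y) -/k in rk maxk ltk.
have P' := profile_slide rk x'E y'E.
have mk' : is_argmax (profile x' y') lo hi k.
  split=> // r rr; rewrite !P' // ltnn.
  by have := maxk r rr; have := ltk r; do !case: ifP; lia.
have lpk : last_peak x' y' = k.
  apply: last_argmax_eq => // r rr; rewrite !P' ?ltnn; [|lia|lia].
  by have := maxk r; do !case: ifP; lia.
have fp' : profile x' y' (first_peak x' y') = profile x y k.
  have [[r1 m1] _] := first_argmaxP (profile x' y') lohi.
  have := m1 k rk; have := mk'.2 _ r1.
  by rewrite -/(first_peak x' y') (P' k) // ltnn; lia.
have lp : profile x y (last_peak x y) = profile x y k.
  have [[r1 m1] _] := last_argmaxP (profile x y) lohi.
  have := m1 k rk; have := maxk _ r1.
  by rewrite -/(last_peak x y); lia.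
split=> //.
  by rewrite !lower_numE -/k fp' (sum_slide_y rk y'E); case: ifP; lia.
rewrite !raise_numE lpk lp (sum_slide_x x'E) (P' k) // ltnn.
by case: ifP; lia.
Qed.

Lemma raise_slide (x y x' y' : nat -> int) (k := last_peak x y) :
  (forall j, x' j = x j + (if j == k then 1 else 0)) ->
  (forall j, y' j = y j - (if j == k then 1 else 0)) ->
  [/\ first_peak x' y' = k, raise_num x' y' = raise_num x y - 1
    & lower_num x' y' = lower_num x y + 1].
Proof.
move=> x'E y'E; have [[rk maxk] ltk] := last_argmaxP (profile x y) lohi.
rewrite -/(last_peak x y) -/k in rk maxk ltk.
have P' := profile_slide rk x'E y'E.
have mk' : is_argmax (profile x' y') lo hi k.
  split=> // r rr; rewrite !P' // ltnn.
  by have := maxk r rr; have := ltk r; do !case: ifP; lia.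
have fpk : first_peak x' y' = k.
  apply: first_argmax_eq => // r rr; rewrite !P' ?ltnn; [|lia|lia].
  by have := maxk r; do !case: ifP; lia.
have lp' : profile x' y' (last_peak x' y') = profile x y k.
  have [[r1 m1] _] := last_argmaxP (profile x' y') lohi.
  have := m1 k rk; have := mk'.2 _ r1.
  by rewrite -/(last_peak x' y') (P' k) // ltnn; lia.
have fp : profile x y (first_peak x y) = profile x y k.
  have [[r1 m1] _] := first_argmaxP (profile x y) lohi.
  have := m1 k rk; have := maxk _ r1.
  by rewrite -/(first_peak x y); lia.
split=> //.
  by rewrite !raise_numE -/k lp' (sum_slide_x x'E); case: ifP; lia.
rewrite !lower_numE fpk fp (sum_slide_y rk y'E) (P' k) // ltnn.
by case: ifP; lia.
Qed.

End Profile.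

(** * Path sums and detours *)

Section Reach.
Variable T : eqType.

(** The possible sums of w along paths of e from a, both ends included; as an
    inductive relation, it allows arguments on the last step of a path. *)
Inductive reach (e : T -> T -> Prop) (w : T -> int) (a : T) : T -> int -> Prop :=
| reach_start : reach e w a a (w a)
| reach_step c d v : reach e w a c v -> e c d -> reach e w a d (v + w d).

Lemma reach_val e w a c v v' : reach e w a c v -> v = v' -> reach e w a c v'.
Proof. by move=> ? <-. Qed.

Definition converse (e : T -> T -> Prop) c d := e d c.

(** A path from a to c and a reversed path from b to c are glued at c, whose
    value would otherwise be counted twice. *)
Lemma reach_converse e w a b v : reach e w a b v -> reach (converse e) w b a v.
Proof.
suff glue c u : reach e w a c u -> forall v', reach (converse e) w b c v' ->
    reach (converse e) w b a (u + v' - w c).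
  by move=> /glue/(_ _ (reach_start _ _ _)) H; apply: reach_val H _; ring.
elim=> [v' H|c' d u' _ IH ecd v' H]; first by apply: reach_val H _; ring.
by apply: reach_val (IH _ (reach_step H ecd)) _; ring.
Qed.

Lemma reach_mono e w w' a c v : (forall x, w' x <= w x) -> reach e w' a c v ->
  exists2 v', reach e w a c v' & v <= v'.
Proof.
move=> le_w; elim=> [|c' d v1 _ [v2 H le12] ecd].
  by exists (w a) => //; apply: reach_start.
by exists (v2 + w d); [apply: reach_step H ecd | apply: lerD].
Qed.

Section Detour.
Variables (e : T -> T -> Prop) (w : T -> int) (a : T).
Variables (X Y : nat -> T) (nxt lt : nat -> nat -> Prop) (S : nat -> int).

(** Two side rails X and Y joined by rungs, such that Y can be entered only
    from X or along Y itself.  The relation nxt is the direction of travel along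
    the rails: abstracting it from the order of nat makes the definition apply
    to reversed paths, which travel by decreasing index.  S is the value of a
    path as a function of its crossing point, up to a constant. *)
Record ladder : Prop := Ladder {
  ladder_start : forall k, a <> Y k;
  ladder_pred : forall c k, e c (Y k) -> c = X k \/ exists2 j, nxt j k & c = Y j;
  ladder_side : forall j k, nxt j k -> e (X j) (X k);
  ladder_rung : forall c k, e c (Y k) -> e (X k) (Y k);
  ladder_disj : forall j k, X j <> Y k;
  ladder_lt : forall j k, nxt j k -> lt j k;
  ladder_lt_trans : forall r j k, lt r j -> lt j k -> lt r k;
  ladder_pot : forall j k, nxt j k -> S k - S j = w (X k) - w (Y j)
}.

Hypothesis L : ladder.

(** A path to Y k left the rail X at some r; staying on X up to k instead
    trades the Y values from r to just before k for the X values after r up to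
    k, a change of S k - S r. *)
Lemma detour k v : reach e w a (Y k) v -> exists2 r, r = k \/ lt r k &
  reach e w a (X k) (v - w (Y k) + S k - S r).
Proof.
move EC: (Y k) => c H; elim: H k EC => [k /esym/(ladder_start L)//|].
move=> c' d u H IH ecd k E; rewrite -E in ecd *.
have [Ec|[j jk Ec]] := ladder_pred L ecd.
  by exists k; [left | rewrite -Ec; apply: reach_val H _; ring].
have [r rj Hr] := IH j (esym Ec); exists r.
  right; case: rj => [->|]; first exact: ladder_lt jk.
  by move/(ladder_lt_trans L); apply; apply: ladder_lt jk.
apply: reach_val (reach_step Hr (ladder_side L jk)) _.
by have := ladder_pot L jk; rewrite Ec; lia.
Qed.

Variables (p : nat) (w' : T -> int).
Hypothesis maxp : forall r, lt r p -> S r < S p.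
Hypothesis w'E : forall c,
  w' c = w c - (if c == X p then 1 else 0) + (if c == Y p then 1 else 0).

(** Sums for the new weight are dominated by sums for the old one.  The extra 1
    at X p is what makes the induction pass: it pays for the unit gained at Y p
    when the path comes from X p.  If the path comes along Y, the detour through
    X p gains at least one. *)
Lemma reach_slide c v : reach e w' a c v ->
  exists2 v', reach e w a c v' & v + (if c == X p then 1 else 0) <= v'.
Proof.
elim=> [|c' d u _ [u' H le_u] ecd].
  exists (w a); first exact: reach_start.
  rewrite w'E; case: (a =P Y p) => [/(ladder_start L)//|_].
  by case: (a == X p); lia.
have le_u' : u <= u' by move: le_u; case: ifP; lia.
have [Ed|dY] := eqVneq d (Y p); last first.
  exists (u' + w d); first exact: reach_step H ecd.
  by rewrite w'E (negPf dY); case: (d == X p); lia.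
have XY : (Y p == X p) = false by apply/eqP => /esym/(ladder_disj L).
rewrite Ed in ecd *; rewrite w'E XY eqxx.
have [Ec|[j jp Ec]] := ladder_pred L ecd.
  exists (u' + w (Y p)); first exact: reach_step H ecd.
  by rewrite Ec eqxx in le_u; lia.
rewrite Ec in H; have [r rj Hr] := detour H.
have rp : lt r p.
  case: rj => [->|]; first exact: ladder_lt jp.
  by move/(ladder_lt_trans L); apply; apply: ladder_lt jp.
eexists; first exact: reach_step (reach_step Hr (ladder_side L jp)) (ladder_rung L ecd).
have := ladder_pot L jp; have := maxp rp; move: le_u; case: ifP; lia.
Qed.

End Detour.
End Reach.

(** * Arrays on the grid and the polytope *)

Section Arrays.
Variables n i : nat.
Hypothesis hi : (1 <= i <= n)%N.
Local Notation array := (array n i).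
Implicit Types (A : array) (c : nat * nat).

Definition in_grid c := (1 <= c.1 <= i)%N && (i <= c.2 <= n)%N.

Definition entry A c : int := ent A c.1 c.2.

Lemma cell_in_grid (x : cell n i) : in_grid (pos x).
Proof.
by case: x => [[[p hp] [q hq]] /= hx]; rewrite /in_grid /pos /=; lia.
Qed.

Lemma pos_inj : injective (@pos n i).
Proof.
move=> [[p q] hx] [[p' q'] hy] [] /= E1 E2.
by apply: val_inj; congr pair; apply: val_inj.
Qed.

Lemma in_gridP c : in_grid c -> exists x : cell n i, pos x = c.
Proof.
case: c => p q; rewrite /in_grid /= => h.
have hp : (p < n.+1)%N by lia.
have hq : (q < n.+1)%N by lia.
have hx : ((1 <= (Ordinal hp, Ordinal hq).1 <= i) && (i <= (Ordinal hp, Ordinal hq).2))%N.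
  by rewrite /=; lia.
by exists (exist _ (Ordinal hp, Ordinal hq) hx).
Qed.

Lemma entry_pos A x : entry A (pos x) = A x.
Proof.
rewrite /entry /ent -surjective_pairing; case: pickP => [y /eqP/pos_inj->//|].
by move/(_ x); rewrite eqxx.
Qed.

Lemma entry_out A c : ~~ in_grid c -> entry A c = 0.
Proof.
move=> out; rewrite /entry /ent -surjective_pairing; case: pickP => // y /eqP E.
by rewrite -E cell_in_grid in out.
Qed.

Lemma entry_add A c d k : in_grid d ->
  entry (add_at A d.1 d.2 k) c = entry A c + (if c == d then k else 0).
Proof.
move=> vd; have [/in_gridP[x <-]|out] := boolP (in_grid c).
  by rewrite !entry_pos ffunE -surjective_pairing.
by rewrite !entry_out //; case: eqP => // E; rewrite E vd in out.
Qed.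

(** Steps between cells of the grid: the bounds on positions then come from
    the steps themselves.  Paths from (1, i) to (i, n) never leave the grid. *)
Definition grid_step c d := [/\ dyck_step c d, in_grid c & in_grid d].

Lemma polytopeP m A : polytope m A <->
  (forall c, 0 <= entry A c) /\
  forall v, reach grid_step (entry A) (1%N, i) (i, n) v -> v <= m%:Z.
Proof.
split=> -[A0 Am]; split.
- move=> c; have [/in_gridP[x <-]|out] := boolP (in_grid c).
    by rewrite entry_pos.
  by rewrite entry_out.
- move=> v; suff gen c u : reach grid_step (entry A) (1%N, i) c u ->
      exists s, [/\ path dyck_step (1%N, i) s, last (1%N, i) s = c
                  & u = \sum_(d <- (1%N, i) :: s) ent A d.1 d.2].
    by case/gen => s [sp sl ->]; apply: Am.
  elim=> [|c' d u' _ [s [sp sl ->]] [st _ _]].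
    by exists [::]; rewrite big_seq1.
  exists (rcons s d); rewrite rcons_path last_rcons sp sl st; split=> //.
  by rewrite -rcons_cons big_rcons.
- by move=> x; rewrite -entry_pos.
move=> s sp sl; apply: Am; rewrite -sl.
have: ((last (1%N, i) s).1 <= i)%N && ((last (1%N, i) s).2 <= n)%N
  by rewrite sl /= !leqnn.
elim/last_ind: s sp {sl} => [|s c IH] /=.
  by rewrite big_seq1 => _ _; apply: reach_start.
rewrite rcons_path last_rcons => /andP[sp st] cle.
have lle : ((last (1%N, i) s).1 <= i)%N && ((last (1%N, i) s).2 <= n)%N.
  by move: st cle => /orP[]/eqP -> /=; lia.
have H := IH sp lle.
have gl : in_grid (last (1%N, i) s).
  by case: H => [|? ? ? _ [] //]; rewrite /in_grid /=; lia.
rewrite -rcons_cons big_rcons /=; apply: reach_step H _; split=> //.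
by move: st cle gl; rewrite /in_grid => /orP[]/eqP -> /=; lia.
Qed.

(** * Moving a unit between adjacent lines *)

(** What the pair of rows l - 1 and l for l > i, and the pair of columns l and
    l + 1 for l < i, have in common. *)
Record line_pair (X Y : nat -> nat * nat) (lo hi : nat) : Prop := LinePair {
  line_ne : (lo <= hi)%N;
  lineX_in : forall k, in_grid (X k) = (lo <= k <= hi)%N;
  lineY_in : forall k, in_grid (Y k) = (lo <= k <= hi)%N;
  lineX_inj : injective X;
  lineY_inj : injective Y;
  line_disj : forall j k, X j <> Y k;
  line_start : forall k, (1%N, i) <> Y k;
  line_end : forall k, (i, n) <> X k;
  line_stepX : forall k, dyck_step (X k) (X k.+1);
  line_stepY : forall k, dyck_step (Y k) (Y k.+1);
  line_cross : forall k, dyck_step (X k) (Y k);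
  line_pred : forall c k, dyck_step c (Y k) ->
    c = X k \/ exists2 j, k = j.+1 & c = Y j;
  line_succ : forall c k, dyck_step (X k) c -> c = Y k \/ c = X k.+1
}.

Definition line_rows l (j : nat) : nat * nat := (j, l).
Definition line_cols l (j : nat) : nat * nat := (l, j).

Lemma rows_line_pair l : (i < l <= n)%N ->
  line_pair (line_rows l.-1) (line_rows l) 1 i.
Proof.
move=> hl; have El : l = l.-1.+1 by lia.
split=> //; rewrite /line_rows /in_grid /dyck_step /=.
- lia.
- by move=> k; lia.
- by move=> k; lia.
- by move=> j k [].
- by move=> j k [].
- by move=> j k []; lia.
- by move=> k []; lia.
- by move=> k []; lia.
- by move=> k; rewrite eqxx orbT.
- by move=> k; rewrite eqxx orbT.
- by move=> k; rewrite -El eqxx.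
- move=> [p q] k /= /orP[]/eqP[-> E]; first by left; congr pair; lia.
  by right; exists p; rewrite // E.
- by move=> [p q] k; rewrite -El => /orP[]/eqP ->; [left|right].
Qed.

Lemma cols_line_pair l : (0 < l < i)%N ->
  line_pair (line_cols l) (line_cols l.+1) i n.
Proof.
move=> hl; split=> //; rewrite /line_cols /in_grid /dyck_step /=.
- lia.
- by move=> k; lia.
- by move=> k; lia.
- by move=> j k [].
- by move=> j k [].
- by move=> j k []; lia.
- by move=> k []; lia.
- by move=> k []; lia.
- by move=> k; rewrite eqxx.
- by move=> k; rewrite eqxx.
- by move=> k; rewrite eqxx orbT.
- move=> [p q] k /= /orP[]/eqP[E1 E2]; first by right; exists q; rewrite // E1.
  by left; congr pair; lia.
- by move=> [p q] k /orP[]/eqP ->; [right|left].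
Qed.

Section LinePair.
Variables (X Y : nat -> nat * nat) (lo h : nat) (m : nat).
Hypothesis L : line_pair X Y lo h.

Let x A j := entry A (X j).
Let y A j := entry A (Y j).

Definition slide A k d := add_at (add_at A (X k).1 (X k).2 d) (Y k).1 (Y k).2 (- d).

Definition line_lower_num A := lower_num lo h (x A) (y A).
Definition line_raise_num A := raise_num lo h (x A) (y A).
Definition line_lower A :=
  if line_lower_num A == 0 then None
  else Some (slide A (first_peak lo h (x A) (y A)) (-1)).
Definition line_raise A :=
  if line_raise_num A == 0 then None
  else Some (slide A (last_peak lo h (x A) (y A)) 1).

Lemma slideK A k d : slide (slide A k d) k (- d) = A.
Proof.
apply/ffunP => c; rewrite !ffunE opprK.
by case: (_ == _); case: (_ == _) => /=; ring.
Qed.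

Lemma entry_slide A k d c : (lo <= k <= h)%N -> entry (slide A k d) c =
  entry A c + (if c == X k then d else 0) - (if c == Y k then d else 0).
Proof.
move=> rk; rewrite !entry_add ?(lineX_in L) ?(lineY_in L) //.
by case: (c == Y k); lia.
Qed.

Lemma slide_x A k d j : (lo <= k <= h)%N ->
  x (slide A k d) j = x A j + (if j == k then d else 0).
Proof.
move=> rk; rewrite /x entry_slide // (inj_eq (lineX_inj L)).
by case: (X j =P Y k) => [/(line_disj L)//|_]; lia.
Qed.

Lemma slide_y A k d j : (lo <= k <= h)%N ->
  y (slide A k d) j = y A j - (if j == k then d else 0).
Proof.
move=> rk; rewrite /y entry_slide // (inj_eq (lineY_inj L)).
by case: (Y j =P X k) => [/esym/(line_disj L)//|_]; lia.
Qed.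

(** Paths from (1, i) can enter the line Y only through the line X. *)
Lemma lower_ladder A : ladder grid_step (entry A) (1%N, i) X Y
  (fun j k => (lo <= j < h)%N /\ k = j.+1)
  (fun j k => (lo <= j < k)%N) (profile lo h (x A) (y A)).
Proof.
split=> //.
- exact: line_start L.
- move=> c k [st gc gY]; have [|[j E Ec]] := line_pred L st; first by left.
  right; exists j => //; split=> //.
  by move: gc gY; rewrite Ec !(lineY_in L) E; lia.
- move=> j k [rj ->]; split; rewrite ?(lineX_in L) ?(line_stepX L) //; lia.
- move=> c k [_ _ gY]; split=> //; first exact: line_cross L _.
  by rewrite (lineX_in L) -(lineY_in L).
- exact: line_disj L.
- by move=> j k [? ->]; lia.
- by move=> r j k; lia.
- by move=> j k [? ->]; apply: (profileS (line_ne L)).  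
Qed.

(** Reversed paths from (i, n) can enter the line X only through the line Y,
    and travel by decreasing index. *)
Lemma raise_ladder A : ladder (converse grid_step) (entry A) (i, n) Y X
  (fun j k => (lo <= k < h)%N /\ j = k.+1)
  (fun j k => (k < j <= h)%N) (profile lo h (x A) (y A)).
Proof.
split=> //.
- exact: line_end L.
- move=> c k [st gX gc]; have [|Ec] := line_succ L st; first by left.
  right; exists k.+1 => //; split=> //.
  by move: gc gX; rewrite Ec !(lineX_in L); lia.
- move=> j k [rk ->]; split; rewrite ?(lineY_in L) ?(line_stepY L) //; lia.
- move=> c k [_ gX _]; split=> //; first exact: line_cross L _.
  by rewrite (lineY_in L) -(lineX_in L).
- by move=> j k /esym/(line_disj L).
- by move=> j k [? ->]; lia.
- by move=> r j k; lia.
- move=> j k [? ->]; have := @profileS lo h (line_ne L) (x A) (y A) k; rewrite /x /y; lia.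
Qed.

(** The profile being strictly smaller before its first maximum, the detour
    through that maximum always gains. *)
Lemma line_lower_step : string_step (@polytope n i m)
  line_lower_num line_raise_num line_lower line_raise.
Proof.
move=> A /polytopeP[A0 Am]; rewrite /line_lower.
have d0 : 0 <= line_lower_num A by apply: lower_num_ge0 => [|j];
    [exact: line_ne L | exact: A0].
split=> //; case: eqP => // dn0; set k := first_peak _ _ _ _.
have [[rk _] ltk] := first_argmaxP (profile lo h (x A) (y A)) (line_ne L).
rewrite -/(first_peak lo h _ _) -/k in rk ltk.
have xk : 0 < x A k by apply: (lower_num_pos (line_ne L)) => [j|];
    [exact: A0 | rewrite -/(line_lower_num A); lia].
have [E Ed Eu] := lower_slide (line_ne L) (fun j => slide_x A (-1) j rk)
  (fun j => slide_y A (-1) j rk).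
exists (slide A k (-1)); split=> //; last first.
  rewrite /line_raise /line_raise_num Eu E ifF;
    first by congr Some; apply: (slideK A k (-1)).
  have : 0 <= line_raise_num A by apply: raise_num_ge0 => [|j];
    [exact: line_ne L | exact: A0].
  by rewrite /line_raise_num; lia.
apply/polytopeP; split=> [c|v].
  rewrite entry_slide //; have := A0 c; move: xk; rewrite /x.
  by case: (c =P X k) => [->|_]; case: ifP; lia.
case/(reach_slide (lower_ladder A) (p := k)).
- by move=> r; apply: ltk.
- by move=> c; rewrite entry_slide //; do !case: ifP; lia.
by move=> v' /Am; case: ifP; lia.
Qed.

(** Dual to line_lower_step, with reversed paths and the last maximum. *)
Lemma line_raise_step : string_step (@polytope n i m)
  line_raise_num line_lower_num line_raise line_lower.
Proof.
move=> A /polytopeP[A0 Am]; rewrite /line_raise.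
have u0 : 0 <= line_raise_num A by apply: raise_num_ge0 => [|j];
    [exact: line_ne L | exact: A0].
split=> //; case: eqP => // un0; set k := last_peak _ _ _ _.
have [[rk _] ltk] := last_argmaxP (profile lo h (x A) (y A)) (line_ne L).
rewrite -/(last_peak lo h _ _) -/k in rk ltk.
have yk : 0 < y A k by apply: (raise_num_pos (line_ne L)) => [j|];
    [exact: A0 | rewrite -/(line_raise_num A); lia].
have [E Eu Ed] := raise_slide (line_ne L) (fun j => slide_x A 1 j rk)
  (fun j => slide_y A 1 j rk).
exists (slide A k 1); split=> //; last first.
  rewrite /line_lower /line_lower_num Ed E ifF;
    first by congr Some; apply: (slideK A k 1).
  have : 0 <= line_lower_num A by apply: lower_num_ge0 => [|j];
    [exact: line_ne L | exact: A0].
  by rewrite /line_lower_num; lia.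
apply/polytopeP; split=> [c|v].
  rewrite entry_slide //; have := A0 c; move: yk; rewrite /y.
  by case: (c =P Y k) => [->|_]; case: ifP; lia.
move/reach_converse; case/(reach_slide (raise_ladder A) (p := k)).
- by move=> r; apply: ltk.
- by move=> c; rewrite entry_slide //; do !case: ifP; lia.
by move=> v' /reach_converse/Am; case: ifP; lia.
Qed.

End LinePair.

(** * The corner entry *)

Section Corner.
Variable m : nat.

Lemma reach_edge w p : (1 <= p <= i)%N ->
  reach grid_step w (1%N, i) (p, i) (\sum_(1 <= j < p.+1) w (j, i)).
Proof.
elim: p => [//|[_ _|p IH hp]]; first by rewrite big_nat1; apply: reach_start.
rewrite big_nat_recr //=; apply: reach_step (IH _) _; first by lia.
by split; rewrite /dyck_step /in_grid /= ?eqxx ?orbT //; lia.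
Qed.

(** The cells (p, i) have a single predecessor in the grid, so only one path
    from (1, i) ends there. *)
Lemma reach_edge_val w p v : reach grid_step w (1%N, i) (p, i) v ->
  v = \sum_(1 <= j < p.+1) w (j, i).
Proof.
move E: (p, i) => c H; elim: H p E => [p [->]|c' d u H IH [st gc gd] p E].
  by rewrite big_nat1.
move: st gc gd; rewrite -E; case: c' H IH => a b _ IH.
move=> /orP[]/eqP[Ep Ei]; rewrite /in_grid /=.
  by rewrite Ei; lia.
move=> ga _; rewrite Ep big_nat_recr /=; last by lia.
by rewrite (IH a) // Ei.
Qed.

(** The path that visits the corner; ending at (i, n), it is the one whose sum
    appears in phi_i. *)
Lemma reach_hook w q : (i <= q <= n)%N -> reach grid_step w (1%N, i) (i, q)
  (\sum_(1 <= j < i) w (j, i) + \sum_(i <= j < q.+1) w (i, j)).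
Proof.
elim: q => [|q IH] hq; first by lia.
have [Eq|] := eqVneq i q.+1.
  rewrite -Eq big_nat1.
  have := @reach_edge w i _; rewrite big_nat_recr /=; [|lia].
  by apply; lia.
move=> ne; rewrite big_nat_recr /=; last by lia.
rewrite addrA; apply: reach_step (IH _) _; first by lia.
by split; rewrite /dyck_step /in_grid /= ?eqxx ?orbT //; lia.
Qed.

(** The corner can only be reached along the first edge and left along the
    second: a path either avoids the corner or is the hook. *)
Lemma reach_corner w w' c v : (forall d, d <> (i, i) -> w' d = w d) ->
  reach grid_step w' (1%N, i) c v ->
  reach grid_step w (1%N, i) c v \/ c.1 = i /\
  v = \sum_(1 <= j < i) w (j, i) + \sum_(i <= j < c.2.+1) w' (i, j).
Proof.
move=> w'E; elim=> [|c' d u _ IH [st gc gd]].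
  have [E|ne] := eqVneq i 1%N.
    right; split=> //=; rewrite big_geq; last by lia.
    by rewrite big_nat1 add0r -E.
  by left; rewrite w'E; [exact: reach_start | case=> E; rewrite -E eqxx in ne].
case: IH => [H|[Ei ->]]; last first.
  right; have Ed : d = (i, c'.2.+1).
    by move: st gd; rewrite /dyck_step /in_grid Ei => /orP[]/eqP -> //=; lia.
  rewrite Ed /= [X in _ = _ + X]big_nat_recr ?addrA //=.
  by move: gc; rewrite /in_grid; lia.
have [Ed|ne] := eqVneq d (i, i); last first.
  left; rewrite w'E; last by apply/eqP.
  exact: reach_step H _.
right; rewrite Ed /= big_nat1; split=> //; congr (_ + _).
move: st gc; rewrite Ed; case: c' H => a b H /orP[]/eqP[Ea Eb]; rewrite /in_grid /=.
  by lia.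
by move=> _; rewrite -Eb in H; rewrite (reach_edge_val H) -Ea.
Qed.

Definition corner_num A : int :=
  m%:Z - \sum_(1 <= j < i) entry A (j, i) - \sum_(i <= j < n.+1) entry A (i, j).
Lemma corner_sum A : \sum_(1 <= j < i) entry A (j, i) +
  \sum_(i <= j < n.+1) entry A (i, j) = m%:Z - corner_num A.
Proof. by rewrite /corner_num; ring. Qed.

Definition corner_inc A :=
  if corner_num A == 0 then None else Some (add_at A i i 1).
Definition corner_dec A :=
  if entry A (i, i) == 0 then None else Some (add_at A i i (-1)).

Lemma corner_in_grid : in_grid (i, i).
Proof. by rewrite /in_grid /=; lia. Qed.

Lemma entry_corner A k c :
  entry (add_at A i i k) c = entry A c + (if c == (i, i) then k else 0).
Proof. exact: (entry_add A c k corner_in_grid). Qed.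

Lemma corner_addK A k : add_at (add_at A i i k) i i (- k) = A.
Proof. by apply/ffunP => c; rewrite !ffunE; case: (_ == _); ring. Qed.

Lemma corner_num_add A k : corner_num (add_at A i i k) = corner_num A - k.
Proof.
rewrite /corner_num.
have -> : \sum_(1 <= j < i) entry (add_at A i i k) (j, i) =
    \sum_(1 <= j < i) entry A (j, i).
  apply: eq_big_nat => j hj; rewrite entry_corner; case: eqP => [[E]|]; lia.
have -> : \sum_(i <= j < n.+1) entry (add_at A i i k) (i, j) =
    \sum_(i <= j < n.+1) entry A (i, j) + k.
  transitivity (\sum_(i <= j < n.+1) (entry A (i, j) + if j == i then k else 0)).
    by apply: eq_bigr => j _; rewrite entry_corner xpair_eqE eqxx.
  by rewrite sum_bump ifT //; lia.
ring.
Qed.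

Lemma corner_num_ge0 A : polytope m A -> 0 <= corner_num A.
Proof.
move=> /polytopeP[_ Am]; have := Am _ (@reach_hook (entry A) n _).
by rewrite /corner_num; lia.
Qed.

Lemma corner_inc_step : string_step (@polytope n i m)
  corner_num (fun A => entry A (i, i)) corner_inc corner_dec.
Proof.
move=> A PA; have c0 := corner_num_ge0 PA; split=> //; rewrite /corner_inc.
case: eqP => // cn0; have [A0 Am] := (polytopeP m A).1 PA.
exists (add_at A i i 1); split=> //.
- apply/polytopeP; split=> [c|v].
    by rewrite entry_corner; have := A0 c; case: ifP; lia.
  case/(@reach_corner (entry A)) => [d /eqP/negPf ne|/Am//|[_ /= ->]].
    by rewrite entry_corner ne addr0.
  have -> : \sum_(1 <= j < i) entry A (j, i) =
      \sum_(1 <= j < i) entry (add_at A i i 1) (j, i).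
    apply: eq_big_nat => j hj; rewrite entry_corner; case: eqP => [[E]|]; lia.
    by rewrite corner_sum corner_num_add; lia.
- by rewrite corner_num_add.
- by rewrite entry_corner eqxx.
rewrite /corner_dec entry_corner eqxx ifF ?corner_addK //.
by have := A0 (i, i); lia.
Qed.

Lemma corner_dec_step : string_step (@polytope n i m)
  (fun A => entry A (i, i)) corner_num corner_dec corner_inc.
Proof.
move=> A PA; have c0 := corner_num_ge0 PA; have [A0 Am] := (polytopeP m A).1 PA.
split=> //; rewrite /corner_dec; case: eqP => // an0.
exists (add_at A i i (-1)); split=> //.
- apply/polytopeP; split=> [c|v].
    by rewrite entry_corner; have := A0 c; case: eqP => [->|]; have := A0 (i, i); lia.
  case/(@reach_mono _ _ (entry A)) => [c|v' /Am]; last by lia.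
  by rewrite entry_corner; case: ifP; lia.
- by rewrite entry_corner eqxx.
- by rewrite corner_num_add opprK.
rewrite /corner_inc corner_num_add opprK ifF; last by lia.
by congr Some; apply: (corner_addK A (-1)).
Qed.

End Corner.

(** * Weights *)

Lemma array_wt_add m A p q k : in_grid (p, q) ->
  array_wt m (add_at A p q k) = array_wt m A - k *: pos_root n p q.
Proof.
move=> gpq; rewrite /array_wt -addrA -opprD; congr (_ - _).
have E a b : ent (add_at A p q k) a b =
    ent A a b + (if (a == p) && (b == q) then k else 0).
  by rewrite -xpair_eqE; apply: (entry_add A (a, b) k gpq).
under eq_bigr do under eq_bigr do rewrite E scalerDl.
under eq_bigr do rewrite big_split /=.
rewrite big_split /=; congr (_ + _).
rewrite (bigD1_seq p) ?iota_uniq ?mem_index_iota //=;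
  last by move: gpq; rewrite /in_grid /=; lia.
rewrite [X in _ + X]big1 => [|a /negPf ne]; last first.
  by rewrite big1 // => b _; rewrite ne scale0r.
rewrite addr0 (bigD1_seq q) ?iota_uniq ?mem_index_iota //=;
  last by move: gpq; rewrite /in_grid /=; lia.
rewrite !eqxx big1 ?addr0 // => b /negPf ne.
by rewrite ne scale0r.
Qed.

(** The pairing of a coroot with a positive root: inside an interval of simple
    roots the contributions 2, -1, -1 cancel, leaving only its end points. *)
Lemma cartan_sum l p q : (p <= q)%N ->
  \sum_(p <= j < q.+1) cartan l j =
  (l == p)%:R + (l == q)%:R - (l.+1 == p)%:R - (l == q.+1)%:R.
Proof.
elim: q => [|q IH] pq.
  have -> : p = 0%N by lia.
  rewrite big_nat1 /cartan; do ![case: eqP => //= ?]; lia.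
have [->|ne] := eqVneq p q.+1.
  rewrite big_nat1 /cartan; do ![case: eqP => //= ?]; lia.
rewrite big_nat_recr //= IH; last by lia.
rewrite /cartan; do ![case: eqP => //= ?]; lia.
Qed.

Lemma coroot_ord l (k : 'I_n) (lam : 'rV[int]_n) : k.+1 = l ->
  coroot l lam = lam 0 k.
Proof.
by move=> <-; rewrite /coroot (big_pred1 k).
Qed.

Lemma simple_root_coord l (k : 'I_n) : simple_root n l 0 k = cartan k.+1 l.
Proof.
rewrite /simple_root summxE (bigD1_seq k.+1) ?iota_uniq ?mem_index_iota //=;
  last by have := ltn_ord k; lia.
rewrite !mxE eqxx mulr1 big1 ?addr0 // => j /negPf ne.
by rewrite !mxE eq_sym ne mulr0.
Qed.

Lemma coroot_wt m l A : (1 <= l <= n)%N -> coroot l (array_wt m A) =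
  (if l == i then m%:Z else 0) -
  \sum_(1 <= p < i.+1) \sum_(i <= q < n.+1) entry A (p, q) *
    ((l == p)%:R + (l == q)%:R - (l.+1 == p)%:R - (l == q.+1)%:R).
Proof.
move=> hl; have kP : (l.-1 < n)%N by lia.
rewrite (@coroot_ord l (Ordinal kP)) /=; last by lia.
rewrite /array_wt !mxE /= prednK; last by lia.
congr (_ - _).
  by rewrite /=; case: eqP; lia.
rewrite summxE; apply: eq_big_nat => p hp; rewrite summxE.
apply: eq_big_nat => q hq; rewrite mxE; congr (_ * _).
rewrite /pos_root summxE -cartan_sum; last by lia.
by apply: eq_bigr => j _; rewrite simple_root_coord /= prednK //; lia.
Qed.

Definition col_sum A p : int := \sum_(i <= q < n.+1) entry A (p, q).
Definition row_sum A q : int := \sum_(1 <= p < i.+1) entry A (p, q).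

Lemma col_sum_out A p : ~~ (1 <= p <= i)%N -> col_sum A p = 0.
Proof.
move=> out; rewrite /col_sum big1 // => q _.
by rewrite entry_out // /in_grid negb_and out.
Qed.

Lemma row_sum_out A q : ~~ (i <= q <= n)%N -> row_sum A q = 0.
Proof.
move=> out; rewrite /row_sum big1 // => p _.
by rewrite entry_out // /in_grid negb_and out orbT.
Qed.

Lemma sum_select (F : nat -> int) k a b :
  (~~ (a <= k < b)%N -> F k = 0) ->
  \sum_(a <= j < b) F j * (k == j)%:R = F k.
Proof.
move=> out; transitivity (\sum_(a <= j < b | j == k) F j).
  rewrite [RHS]big_mkcond; apply: eq_bigr => j _; rewrite eq_sym.
  by case: eqP; rewrite ?mulr1 ?mulr0.
by rewrite big_nat1_eq; case: ifP => // /negbT/out.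
Qed.

Lemma sum_col A k : \sum_(1 <= p < i.+1) \sum_(i <= q < n.+1)
  entry A (p, q) * (k == p)%:R = col_sum A k.
Proof.
under eq_bigr do rewrite -mulr_suml.
by apply: (@sum_select (col_sum A)); apply: col_sum_out.
Qed.

Lemma sum_row A k : \sum_(1 <= p < i.+1) \sum_(i <= q < n.+1)
  entry A (p, q) * (k == q)%:R = row_sum A k.
Proof.
rewrite exchange_big_nat; under eq_bigr do rewrite -mulr_suml.
by apply: (@sum_select (row_sum A)); apply: row_sum_out.
Qed.

(** Sums along lines outside the grid vanish, so this single formula covers
    l < i, l = i and l > i. *)
Lemma coroot_wt_sums m l A : (1 <= l <= n)%N -> coroot l (array_wt m A) =
  (if l == i then m%:Z else 0) - col_sum A l - row_sum A l
  + col_sum A l.+1 + row_sum A l.-1.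
Proof.
move=> hl.
have E p q : entry A (p, q) *
    ((l == p)%:R + (l == q)%:R - (l.+1 == p)%:R - (l == q.+1)%:R) =
    entry A (p, q) * (l == p)%:R + entry A (p, q) * (l == q)%:R
    - entry A (p, q) * (l.+1 == p)%:R - entry A (p, q) * (l.-1 == q)%:R.
  by have -> : (l == q.+1) = (l.-1 == q) by [lia]; ring.
rewrite coroot_wt //; under eq_bigr do under eq_bigr do rewrite E.
under eq_bigr do rewrite !sumrB big_split /=.
rewrite !sumrB big_split /= !sum_col !sum_row.
ring.
Qed.

Lemma array_wt_slide m X Y lo h A k d : line_pair X Y lo h -> (lo <= k <= h)%N ->
  array_wt m (slide X Y A k d) = array_wt m A
    - d *: (pos_root n (X k).1 (X k).2 - pos_root n (Y k).1 (Y k).2).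
Proof.
move=> L rk; rewrite !array_wt_add -?surjective_pairing ?(lineX_in L) ?(lineY_in L) //.
by rewrite scalerBr scaleNr opprB opprK -addrA; congr (_ + _); rewrite addrC.
Qed.

Lemma pos_root_recr p l : (p < l)%N ->
  pos_root n p l = pos_root n p l.-1 + simple_root n l.
Proof. by case: l => // l pl; rewrite /pos_root big_nat_recr //=; apply: ltnW. Qed.

Lemma pos_root_recl l q : (l < q.+1)%N ->
  pos_root n l q = simple_root n l + pos_root n l.+1 q.
Proof. by move=> lq; rewrite /pos_root big_ltn. Qed.

(** * The crystal structure *)

(** Everything that the crystal axioms say about one index l; the weights of
    e_l follow from those of f_l, its partial inverse. *)
Lemma array_string_step m l : (1 <= l <= n)%N ->
  [/\ string_step (@polytope n i m) (array_eps l) (array_phi m l)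
        (@array_e n i l) (array_f m l),
      string_step (@polytope n i m) (array_phi m l) (array_eps l)
        (array_f m l) (@array_e n i l),
      (forall A, array_phi m l A = array_eps l A + coroot l (array_wt m A)) &
      forall A A', array_f m l A = Some A' ->
        array_wt m A' = array_wt m A - simple_root n l].
Proof.
move=> hl; have [El|il|li] := ltngtP i l.
- have L : line_pair (line_rows l.-1) (line_rows l) 1 i by apply: rows_line_pair; lia.
  have li : (l == i) = false by lia.
  have Eeps A : array_eps l A = line_raise_num (line_rows l.-1) (line_rows l) 1 i A.
    by rewrite /array_eps li El.
  have Ephi A : array_phi m l A = line_lower_num (line_rows l.-1) (line_rows l) 1 i A.
    by rewrite /array_phi li El.
  have Ee A : array_e l A = line_raise (line_rows l.-1) (line_rows l) 1 i A.
    by rewrite /array_e Eeps li El.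
  have Ef A : array_f m l A = line_lower (line_rows l.-1) (line_rows l) 1 i A.
    by rewrite /array_f Ephi li El.
  split.
  + by apply: string_step_ext Eeps Ephi Ee Ef _; apply: line_raise_step.
  + by apply: string_step_ext Ephi Eeps Ef Ee _; apply: line_lower_step.
  + move=> A; rewrite Ephi Eeps coroot_wt_sums // li.
    rewrite (@col_sum_out A l) ?(@col_sum_out A l.+1); [|lia|lia].
    have := raise_sub_lower (line_ne L) (fun j => entry A (j, l.-1))
      (fun j => entry A (j, l)).
    rewrite -/(row_sum A l) -/(row_sum A l.-1).
    by rewrite /line_raise_num /line_lower_num /line_rows; lia.
  + move=> A A'; rewrite Ef /line_lower; case: ifP => // _ [<-].
    have [[rp _] _] := first_argmaxP (profile 1 i (fun j => entry A (j, l.-1))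
      (fun j => entry A (j, l))) (line_ne L).
    rewrite (array_wt_slide _ _ _ L rp) /= (@pos_root_recr _ l); last first.
      by move: rp; rewrite /first_peak; lia.
    by rewrite scaleN1r opprK opprD addNKr.
- have L : line_pair (line_cols l) (line_cols l.+1) i n by apply: cols_line_pair; lia.
  have li : (l == i) = false by lia.
  have il' : (i < l)%N = false by lia.
  have Eeps A : array_eps l A = line_lower_num (line_cols l) (line_cols l.+1) i n A.
    by rewrite /array_eps li il'.
  have Ephi A : array_phi m l A = line_raise_num (line_cols l) (line_cols l.+1) i n A.
    by rewrite /array_phi li il'.
  have Ee A : array_e l A = line_lower (line_cols l) (line_cols l.+1) i n A.
    by rewrite /array_e Eeps li il'.
  have Ef A : array_f m l A = line_raise (line_cols l) (line_cols l.+1) i n A.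
    by rewrite /array_f Ephi li il'.
  split.
  + by apply: string_step_ext Eeps Ephi Ee Ef _; apply: line_lower_step.
  + by apply: string_step_ext Ephi Eeps Ef Ee _; apply: line_raise_step.
  + move=> A; rewrite Ephi Eeps coroot_wt_sums // li.
    rewrite (@row_sum_out A l) ?(@row_sum_out A l.-1); [|lia|lia].
    have := raise_sub_lower (line_ne L) (fun j => entry A (l, j))
      (fun j => entry A (l.+1, j)).
    rewrite -/(col_sum A l) -/(col_sum A l.+1).
    by rewrite /line_raise_num /line_lower_num /line_cols; lia.
  + move=> A A'; rewrite Ef /line_raise; case: ifP => // _ [<-].
    have [[rq _] _] := last_argmaxP (profile i n (fun j => entry A (l, j))
      (fun j => entry A (l.+1, j))) (line_ne L).
    rewrite (array_wt_slide _ _ _ L rq) /= pos_root_recl; last first.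
      by move: rq; rewrite /last_peak; lia.
    by rewrite addrK scale1r.
rewrite -li.
have Eeps A : array_eps i A = entry A (i, i) by rewrite /array_eps eqxx.
have Ephi A : array_phi m i A = corner_num m A by rewrite /array_phi eqxx.
have Ee A : array_e i A = corner_dec A by rewrite /array_e Eeps eqxx.
have Ef A : array_f m i A = corner_inc m A by rewrite /array_f Ephi eqxx.
split.
+ by apply: string_step_ext Eeps Ephi Ee Ef _; apply: corner_dec_step.
+ by apply: string_step_ext Ephi Eeps Ef Ee _; apply: corner_inc_step.
+ move=> A; rewrite Ephi Eeps coroot_wt_sums // eqxx.
  rewrite (@col_sum_out A i.+1) ?(@row_sum_out A i.-1); [|lia|lia].
  rewrite /corner_num -/(col_sum A i) /row_sum big_nat_recr /=; last by lia.
  ring.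
+ move=> A A'; rewrite Ef /corner_inc; case: ifP => // _ [<-].
  rewrite array_wt_add ?corner_in_grid // scale1r.
  by rewrite /pos_root big_nat1.
Qed.

End Arrays.

Theorem theorem3p2p1 (n i m : nat) (hn : (1 <= n)%N) (hi : (1 <= i <= n)%N) :
  abstract_crystal (@polytope n i m) (array_crystal n i m) /\
  semiregular (@polytope n i m) (array_crystal n i m).
Proof.
split; last first.
  move=> l A hl PA; have [He Hf _ _] := array_string_step hi m hl.
  by split; [apply: string_step_max He PA | apply: string_step_max Hf PA].
split=> l A.
- move=> A' hl PA eA; have [He _ _ _] := array_string_step hi m hl.
  by case: (string_stepP He PA eA).
- move=> A' hl PA fA; have [_ Hf _ _] := array_string_step hi m hl.
  by case: (string_stepP Hf PA fA).
- by move=> hl _; have [_ _ Hw _] := array_string_step hi m hl; rewrite /= Hw.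
- move=> A' hl PA eA; have [He _ _ Hw] := array_string_step hi m hl.
  have [_ _ _ fA'] := string_stepP He PA eA.
  by rewrite /= (Hw _ _ fA') subrK.
- by move=> A' hl _; have [_ _ _ Hw] := array_string_step hi m hl; apply: Hw.
- move=> A' hl PA eA; have [He _ _ _] := array_string_step hi m hl.
  by have [_ /= -> -> _] := string_stepP He PA eA.
- move=> A' hl PA fA; have [_ Hf _ _] := array_string_step hi m hl.
  by have [_ /= -> -> _] := string_stepP Hf PA fA.
- move=> A' hl PA PA'; have [He Hf _ _] := array_string_step hi m hl.
  by split=> [/(string_stepP Hf PA)[]|/(string_stepP He PA')[]].
- by [].
Qed.
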